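(* Let $n\ge1$, $\sigma\in S_{2n}$ and $D\in\mathcal{D}_n$. If $D^\sigma$ is (the circular representation of) some Dyck path $P\in\mathcal{D}_n$, i.e. $\tau_{D^\sigma}=\tau_P$, then $P=\lambda(D)$ where $\lambda=\sigma^{-1}$.
   Context: A Dyck path of size $n$ is a word $P=P_1\cdots P_{2n}$ in the letters $\mathtt{u},\mathtt{d}$ with $n$ of each letter such that every prefix has at least as many $\mathtt{u}$'s as $\mathtt{d}$'s; $\mathcal{D}_n$ is the set of them. The tunneling $\tau_D\in S_{2n}$ of $D\in\mathcal{D}_n$ is the fixed-point-free involution pairing each up-step position with the position of its matching down-step. For $\sigma\in S_{2n}$ write $\sigma_k=\sigma(k)$, $\sigma_{[k]}=\{\sigma_1,\dots,\sigma_k\}$. The $\sigma$-path $\sigma(D)$ is the word of length $2n$ with $\sigma(D)_k=\mathtt{u}$ if $\tau_D(\sigma_k)\notin\sigma_{[k]}$ and $\mathtt{d}$ otherwise. The permuted circular representation $D^\sigma$ is the pairing of $[2n]$ (placed as labels $\sigma_1,\dots,\sigma_{2n}$ clockwise on a circle) in which $\sigma_k$ and $\sigma_\ell$ are joined whenever $\tau_D(k)=\ell$; its tunneling is the involution $\tau_{D^\sigma}$ with $\tau_{D^\sigma}(\sigma(k))=\sigma(\tau_D(k))$ for all $k$, i.e. $\tau_{D^\sigma}=\sigma\tau_D\sigma^{-1}$. We say $D^\sigma$ is a path $P$ if $\tau_{D^\sigma}=\tau_P$ for some $P\in\mathcal{D}_n$. *)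

(* Defs.v *)
From mathcomp Require Import all_boot all_fingroup.
From mathcomp Require Import zify.

Set Implicit Arguments.
Unset Strict Implicit.
Unset Printing Implicit Defensive.

Notation up := true (only parsing).
Notation down := false (only parsing).

Definition is_dyck (n : nat) (w : seq bool) : bool :=
  [&& count_mem up w == n, count_mem down w == n
    & all (fun k => count_mem down (take k w) <= count_mem up (take k w))
          (iota 0 (size w).+1)].

Record dyck (n : nat) := Dyck {
  dyck_word :> n.*2.-tuple bool;
  dyckP : is_dyck n dyck_word
}.

(* Letters strictly between positions i and j, for i < j. *)
Definition between (w : seq bool) (i j : nat) : seq bool :=
  take (j - i.+1) (drop i.+1 w).

(* The down-step at j matches the up-step at i: the word factors as
   A u B d C with the displayed letters at positions i and j and B a
   Dyck path.  Positions are numbered from 0. *)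
Definition matched (w : seq bool) (i j : nat) : bool :=
  [&& i < j < size w, nth down w i == up, nth up w j == down
    & is_dyck (size (between w i j))./2 (between w i j)].

Section Matching.

Variables (n : nat) (D : dyck n).
Implicit Types (p : bool) (i j k : nat).

Let cnt p k := count_mem p (take k D).

Let szD : size D = n.*2. Proof. exact: size_tuple. Qed.

Let cntS p k : k < n.*2 -> cnt p k.+1 = cnt p k + (nth down D k == p).
Proof.
by move=> ltk; rewrite /cnt (take_nth down) ?szD // -cats1 count_cat /= addn0.
Qed.

Let cnt_full p : cnt p n.*2 = n.
Proof.
by rewrite /cnt take_oversize ?szD //; case/and3P: (dyckP D) => /eqP U /eqP V _; case: p.
Qed.

Let cnt_le k : k <= n.*2 -> cnt down k <= cnt up k.
Proof.
move=> lek; case/and3P: (dyckP D) => _ _ /allP; apply.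
by rewrite mem_iota szD.
Qed.

Let cnt_cat p i k :
  i <= k -> cnt p k = cnt p i + count_mem p (take (k - i) (drop i D)).
Proof.
by move=> leik; rewrite /cnt -{1}(subnKC leik) takeD count_cat.
Qed.

Let count_ud (s : seq bool) : count_mem up s + count_mem down s = size s.
Proof. by elim: s => //= -[] s /=; lia. Qed.

Let matchedP i j : j < n.*2 ->
  reflect [/\ i < j, nth down D i = up, nth down D j = down,
              cnt up j + cnt down i.+1 = cnt down j + cnt up i.+1
            & forall k, i < k <= j ->
                cnt down k + cnt up i.+1 <= cnt up k + cnt down i.+1]
          (matched D i j).
Proof.
move=> ltj; rewrite /matched szD ltj andbT (set_nth_default down) ?szD //.
have szb : i < j -> size (between D i j) = j - i.+1.
  by move=> ltij; rewrite size_takel // size_drop szD; lia.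
have tkb k : i < k <= j -> take (k - i.+1) (between D i j)
                           = take (k - i.+1) (drop i.+1 D).
  by move=> /andP[ltik lekj]; rewrite take_takel //; lia.
apply: (iffP and4P) => [[ltij /eqP Di /eqP Dj]|[ltij Di Dj Ej Hk]].
  case/and3P=> /eqP Eu /eqP Ed /allP Hall; split=> //.
    rewrite (cnt_cat up ltij) (cnt_cat down ltij).
    by move: Eu Ed; rewrite /between => -> ->; lia.
  move=> k ltk; have /andP[ltik lekj] := ltk.
  have := Hall (k - i.+1); rewrite mem_iota szb // tkb //.
  have -> : 0 <= k - i.+1 < 0 + (j - i.+1).+1 by lia.
  move=> /(_ isT).
  by rewrite (cnt_cat up ltik) (cnt_cat down ltik); lia.
split=> //; try exact/eqP.
have Eud : count_mem up (between D i j) = count_mem down (between D i j).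
  by move: Ej; rewrite (cnt_cat up ltij) (cnt_cat down ltij) /between; lia.
have := count_ud (between D i j).
rewrite -Eud => Es; apply/and3P; split; rewrite -?Eud; try by apply/eqP; lia.
apply/allP=> k; rewrite mem_iota szb // => ltk.
have ltk' : i < k + i.+1 <= j by lia.
have ltik : i < k + i.+1 by lia.
have := Hk _ ltk'; have := tkb _ ltk'; rewrite addnK => ->.
by rewrite (cnt_cat up ltik) (cnt_cat down ltik) addnK; lia.
Qed.

Let ex_down i : i < n.*2 -> nth down D i = up -> exists2 j, j < n.*2 & matched D i j.
Proof.
move=> lti Di.
pose Q k := (i < k <= n.*2) && (cnt up k + cnt down i.+1 < cnt down k + cnt up i.+1).
have exQ : exists k, Q k.
  exists n.*2; rewrite /Q !cnt_full !cntS // Di /= lti leqnn.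
  by have := cnt_le (ltnW lti); lia.
case: (ex_minnP exQ) => -[|j]; rewrite /Q // => /andP[ltj Hj] minj.
have ltj2 : j < n.*2 by lia.
have neij : i != j.
  by apply/eqP=> eij; move: Hj; rewrite eij; lia.
have Hk k : i < k <= j -> cnt down k + cnt up i.+1 <= cnt up k + cnt down i.+1.
  move=> ltk; rewrite leqNgt; apply/negP=> Hlt.
  by have := minj k; rewrite /Q Hlt andbT; lia.
exists j => //; apply/(matchedP _ ltj2).
have := Hk j; move: Hj; rewrite (cntS up ltj2) (cntS down ltj2).
have ltij : i < j by lia.
by case Dj: (nth down D j) => /= *; split=> //; lia.
Qed.

Let ex_up j : j < n.*2 -> nth down D j = down -> exists i, matched D i j.
Proof.
move=> ltj Dj.
pose Q i := (i < j) && (cnt up i + cnt down j < cnt down i + cnt up j).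
have cnt0 p : cnt p 0 = 0 by rewrite /cnt take0.
have exQ : exists i, Q i.
  exists 0; rewrite /Q !cnt0.
  have := cnt_le ltj; rewrite !cntS // Dj /= => H.
  case: (posnP j) => [j0|]; last by lia.
  by move: H; rewrite j0 !cnt0.
have ubQ i : Q i -> i <= j by case/andP=> /ltnW.
case: (ex_maxnP exQ ubQ) => i /andP[ltij Hi] maxi.
have Hm k : i < k <= j -> cnt down k + cnt up j <= cnt up k + cnt down j.
  move=> ltk; rewrite leqNgt; apply/negP=> Hlt.
  have nekj : k != j by apply/eqP=> ekj; move: Hlt; rewrite ekj; lia.
  by have := maxi k; rewrite /Q Hlt andbT; lia.
exists i; apply/(matchedP _ ltj).
have lti : i < n.*2 by lia.
have Hi1 := Hm i.+1; move: Hi1; rewrite (cntS up lti) (cntS down lti).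
case Di: (nth down D i) => /= Hi1; last by lia.
split=> //; first by lia.
by move=> k /Hm; lia.
Qed.

Definition partner (i j : 'I_n.*2) : bool := matched D i j || matched D j i.

Lemma partner_sym (i j : 'I_n.*2) : partner i j = partner j i.
Proof. by rewrite /partner orbC. Qed.

Lemma partner_ex (i : 'I_n.*2) : exists j : 'I_n.*2, partner i j.
Proof.
case Di: (nth down D i).
  have [j ltj mij] := ex_down (ltn_ord i) Di.
  by exists (Ordinal ltj); rewrite /partner mij.
have [j mji] := ex_up (ltn_ord i) Di.
have ltj : j < n.*2 by case/(matchedP _ (ltn_ord i)): mji => ? *; have := ltn_ord i; lia.
by exists (Ordinal ltj); rewrite /partner mji orbT.
Qed.

Let uniq_down i j j' : j < n.*2 -> j' < n.*2 ->
  matched D i j -> matched D i j' -> j <= j'.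
Proof.
move=> ltj ltj' /(matchedP _ ltj)[ltij _ _ _ H] /(matchedP _ ltj')[ltij' _ Dj' E' _].
rewrite leqNgt; apply/negP=> lt; have := H j'.+1.
by rewrite !(cntS _ ltj') Dj' /=; lia.
Qed.

Let uniq_up i i' j : j < n.*2 -> matched D i j -> matched D i' j -> i <= i'.
Proof.
move=> ltj /(matchedP _ ltj)[ltij Di _ E _] /(matchedP _ ltj)[ltij' _ _ E' H].
rewrite leqNgt; apply/negP=> lt; have := H i.
have lti : i < n.*2 by lia.
by move: E; rewrite !(cntS _ lti) Di /=; lia.
Qed.

Lemma partner_uniq (i j j' : 'I_n.*2) : partner i j -> partner i j' -> j = j'.
Proof.
rewrite /partner => /orP[] Hj /orP[] Hj'; apply/val_inj/eqP; rewrite eqn_leq.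
- by rewrite (uniq_down _ _ Hj Hj') ?(uniq_down _ _ Hj' Hj).
- case/(matchedP _ (ltn_ord j)): Hj => _ Di _ _ _.
  by case/(matchedP _ (ltn_ord i)): Hj' => _ _; rewrite Di.
- case/(matchedP _ (ltn_ord i)): Hj => _ _ Di _ _.
  by case/(matchedP _ (ltn_ord j')): Hj' => _; rewrite Di.
- by rewrite (uniq_up _ Hj Hj') ?(uniq_up _ Hj' Hj).
Qed.

Definition tunneling_fun (i : 'I_n.*2) : 'I_n.*2 := odflt i [pick j | partner i j].

Lemma tunneling_funP (i : 'I_n.*2) : partner i (tunneling_fun i).
Proof.
rewrite /tunneling_fun; case: pickP => //= no.
by have [j] := partner_ex i; rewrite no.
Qed.

Lemma tunneling_funK : involutive tunneling_fun.
Proof.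
move=> i; apply: (@partner_uniq (tunneling_fun i)); first exact: tunneling_funP.
by rewrite partner_sym tunneling_funP.
Qed.

Definition tunneling : 'S_n.*2 := perm (can_inj tunneling_funK).

Lemma tunnelingP (i : 'I_n.*2) : partner i (tunneling i).
Proof. by rewrite permE; apply: tunneling_funP. Qed.

Lemma tunnelingK : involutive tunneling.
Proof. by move=> i; rewrite !permE tunneling_funK. Qed.

Lemma tunneling_neq (i : 'I_n.*2) : tunneling i != i.
Proof.
apply/eqP=> E; have := tunnelingP i; rewrite E /partner orbb.
by case/(matchedP _ (ltn_ord i)); rewrite ltnn.
Qed.

End Matching.

(* The set of the first k+1 values of s, positions being numbered from 0. *)
Definition prefix_set (m : nat) (s : 'S_m) (k : 'I_m) : {set 'I_m} :=
  [set s i | i : 'I_m & i <= k].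

Definition sigma_path (n : nat) (s : 'S_n.*2) (D : dyck n) : n.*2.-tuple bool :=
  [tuple if tunneling D (s k) \notin prefix_set s k then up else down
    | k < n.*2].

(* Permutations compose from left to right, so this is the map
   x |-> s (tunneling D (s^-1 x)). *)
Definition circular_tunneling (n : nat) (s : 'S_n.*2) (D : dyck n) : 'S_n.*2 :=
  (s^-1 * tunneling D * s)%g.

Lemma circular_tunnelingE (n : nat) (s : 'S_n.*2) (D : dyck n) k :
  circular_tunneling s D (s k) = s (tunneling D k).
Proof. by rewrite /circular_tunneling !permM permK. Qed.

(* Main.v *)
Require Import Defs.
From mathcomp Require Import all_boot all_fingroup.

(* Step k of a Dyck path P is up exactly when k < tau_P(k).  Since
   tau_P(k) = s(tau_D(s^-1(k))), this says that tau_D(s^-1(k)) is not among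
   the first k values of s^-1, which is the rule defining the s^-1-path of D. *)

Lemma mem_prefix_set (m : nat) (s : 'S_m) (k x : 'I_m) :
  (x \in prefix_set s k) = ((s^-1)%g x <= k).
Proof.
apply/imsetP/idP => [[i + ->]|xk]; first by rewrite permK inE.
by exists ((s^-1)%g x); rewrite ?inE ?permKV.
Qed.

(** [matched] puts the up-step before the down-step, so the two disjuncts of [partner] settle both
    the letter at k and the side of its partner. *)
Lemma tnth_dyck_tunneling (n : nat) (P : dyck n) (k : 'I_n.*2) :
  tnth P k = (k < tunneling P k).
Proof.
(* [matched] reads its down-step with default [true]; only the up-step case must change the
   default. *)
rewrite (tnth_nth true).
have /orP[/and4P[/andP[lt _] up _ _]|/and4P[/andP[lt _] _ dn _]] :=
  tunnelingP P k.
- by rewrite lt (set_nth_default false) ?size_tuple //; apply/eqP.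
- by rewrite (eqP dn) ltnNge (ltnW lt).
Qed.

Theorem theorem2 (n : nat) (hn : 1 <= n) (s : 'S_n.*2) (D P : dyck n)
  (hP : circular_tunneling s D = tunneling P) :
  dyck_word P = sigma_path (s^-1)%g D.
Proof.
apply: eq_from_tnth => k.
(* Membership in a prefix of s^-1 is tested through s, so both letters reduce to k <
   s(tau_D(s^-1(k))). *)
rewrite tnth_dyck_tunneling tnth_mktuple mem_prefix_set invgK -hP -ltnNge.
by rewrite /circular_tunneling !permM; case: ifP.
Qed.
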